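(* Let $\mathcal{A}$ be an alphabet, let $x\ge 1$ and $y\ge 2$ be integers, let $u$ be a universal partial cycle for $\mathcal{A}^x$, and let $s$ be a De Bruijn cycle for $\{0,\ldots,|u|-1\}^y$. Then the torus $m(u,s)$ covers every matrix in $\mathcal{A}^{(y+1)\times x}$ exactly once.
   Context: An alphabet $\mathcal{A}$ is a finite nonempty set, and $\diamond\notin\mathcal{A}$ is a wildcard symbol. A cyclic partial word over $\mathcal{A}$ is a cyclic sequence over $\mathcal{A}\cup\{\diamond\}$, indices being read modulo its length $|u|$. It covers a word $v$ at position $i$ if $v$ is obtained from the $|v|$ consecutive symbols starting at index $i$ (read cyclically) by replacing each $\diamond$ by some letter of $\mathcal{A}$ (independently for different places). A universal partial cycle (upcycle) for $\mathcal{A}^x$ is a cyclic partial word over $\mathcal{A}$ that covers every word in $\mathcal{A}^x$ exactly once, i.e. at exactly one position. A De Bruijn cycle for $\mathcal{B}^y$ is a cyclic word over $\mathcal{B}$ in which every word in $\mathcal{B}^y$ appears exactly once. Fix linear representations $u=u_0\cdots u_{|u|-1}$ and $s=s_0\cdots s_{|s|-1}$ of the cyclic objects. Let $\sigma(c_0c_1\cdots c_{k-1})=c_1\cdots c_{k-1}c_0$ be forward rotation and $\sigma^i$ its $i$-fold iterate. Define $\phi_0=\sigma^{s_0}(u)$ and $\phi_n=\sigma^{s_n}(\phi_{n-1})$ for $1\le n\le |s|-1$. Then $m(u,s)$ is the $|s|\times|u|$ matrix with rows $\phi_0,\phi_1,\ldots,\phi_{|s|-1}$ from top to bottom. A partial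 torus over $\mathcal{A}$ is a matrix with entries in $\mathcal{A}\cup\{\diamond\}$ whose row and column indices are both read cyclically. It covers $P\in\mathcal{A}^{w\times\ell}$ (the set of matrices over $\mathcal{A}$ with $w$ rows and $\ell$ columns) at position $(r,c)$ if $P$ is obtained from the $w\times\ell$ array of entries in consecutive rows $r,\ldots,r+w-1$ and consecutive columns $c,\ldots,c+\ell-1$ (read cyclically) by replacing each $\diamond$ by some letter of $\mathcal{A}$; ''exactly once'' means at exactly one position of the torus. *)

(* Defs.v *)
From mathcomp Require Import all_boot all_algebra.

Set Implicit Arguments.
Unset Strict Implicit.
Unset Printing Implicit Defensive.

(* A symbol of the alphabet A extended with the wildcard is an [option A], the
   wildcard being [None].  A cyclic (partial) word of length n is given by a
   linear representation, an n-tuple. *)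

Definition cyc_shift (n : nat) (i : 'I_n) (k : nat) : 'I_n :=
  Ordinal (ltn_pmod (i + k) (leq_ltn_trans (leq0n i) (ltn_ord i))).

Definition fills (A : Type) (a : A) (c : option A) : Prop :=
  exists b : A, a = odflt b c.

(* The window may wrap around the cycle several times (x > n); each place of
   the window is then still filled independently. *)
Definition covers_at (A : Type) (n x : nat) (u : n.-tuple (option A))
    (v : x.-tuple A) (i : 'I_n) : Prop :=
  forall k : 'I_x, fills (tnth v k) (tnth u (cyc_shift i k)).

Definition upcycle (A : Type) (n x : nat) (u : n.-tuple (option A)) : Prop :=
  forall v : x.-tuple A, exists! i : 'I_n, covers_at u v i.

Definition occurs_at (B : Type) (N y : nat) (s : N.-tuple B)
    (v : y.-tuple B) (i : 'I_N) : Prop :=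
  forall k : 'I_y, tnth v k = tnth s (cyc_shift i k).

Definition de_bruijn_cycle (B : Type) (N y : nat) (s : N.-tuple B) : Prop :=
  forall v : y.-tuple B, exists! i : 'I_N, occurs_at s v i.

Definition sigma (T : Type) (n : nat) (c : n.-tuple T) : n.-tuple T :=
  [tuple of rot 1 c].

(* [scanl] omits the initial value [u], so the first entry is
   sigma^(s_0) u and each later one is sigma^(s_k) of its predecessor. *)
Definition phi (T : Type) (n N : nat) (u : n.-tuple T) (s : N.-tuple 'I_n) :
    N.-tuple (n.-tuple T) :=
  [tuple of scanl (fun w (k : 'I_n) => iter k (@sigma T n) w) u s].

Definition torus_of (T : Type) (n N : nat) (u : n.-tuple T)
    (s : N.-tuple 'I_n) : 'M[T]_(N, n) :=
  \matrix_(i < N, j < n) tnth (tnth (phi u s) i) j.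

Definition torus_covers_at (A : Type) (N n w l : nat)
    (M : 'M[option A]_(N, n)) (P : 'M[A]_(w, l)) (p : 'I_N * 'I_n) : Prop :=
  forall (i : 'I_w) (j : 'I_l),
    fills (P i j) (M (cyc_shift p.1 i) (cyc_shift p.2 j)).

(* Main.v *)
Require Import Defs.
From mathcomp Require Import all_boot all_algebra.

(** Let [q_i] be the unique position of [u] at which row [i] of [P] is covered.
    Row [r] of the torus is [u] rotated by the prefix sum
    [R_r = s_0 + ... + s_r], so [P] is covered at [(r, c)] exactly when
    [c + R_(r+i) = q_i] modulo [n] for every [i <= y].

    If the relation [R_(r+1) = R_r + s_(r+1)] modulo [n] holds for all cyclic
    row indices, these [y + 1] equations say that [c + R_r = q_0] and that the
    word of differences [q_(i+1) - q_i], of length [y], occurs in [s] at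
    position [r + 1] ([torus_covers_atP]).  The De Bruijn property then determines [r],
    and the first equation determines [c].

    The relation is clear except from the last row to row [0], where it says
    that the letters of [s] sum to [0] modulo [n] ([dvdn_sum_de_bruijn]).
    This is where [2 <= y] enters: the sum of the letters of [s] is the sum over
    all words of length [y] of their first letter, and the words with a
    prescribed second letter contribute an amount independent of that letter,
    so that the total is [n] times this amount. *)

Set Implicit Arguments.
Unset Strict Implicit.
Unset Printing Implicit Defensive.

(** * Cyclic shifts of positions *)

Lemma cyc_shift0 n (i : 'I_n) : cyc_shift i 0 = i.
Proof. by apply: val_inj; rewrite /= addn0 modn_small. Qed.

Lemma cyc_shiftD n (i : 'I_n) k l :
  cyc_shift (cyc_shift i k) l = cyc_shift i (k + l).
Proof. by apply: val_inj; rewrite /= modnDml addnA. Qed.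

Lemma cyc_shiftAC n (i : 'I_n) k l :
  cyc_shift (cyc_shift i k) l = cyc_shift (cyc_shift i l) k.
Proof. by rewrite !cyc_shiftD addnC. Qed.

Lemma eq_cyc_shift n (i : 'I_n) k l :
  k = l %[mod n] -> cyc_shift i k = cyc_shift i l.
Proof. by move=> kl; apply: val_inj; rewrite /= -modnDmr kl modnDmr. Qed.

Lemma cyc_shiftC n (i j : 'I_n) : cyc_shift i j = cyc_shift j i.
Proof. by apply: val_inj; rewrite /= addnC. Qed.

(** Reducing [k] modulo [n] keeps the truncated subtraction exact. *)
Definition cyc_unshift n (i : 'I_n) (k : nat) : 'I_n :=
  cyc_shift i (n - k %% n).

Lemma cyc_shiftK n k :
  cancel (fun i : 'I_n => cyc_shift i k) (fun i => cyc_unshift i k).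
Proof.
move=> i; have n_gt0 : 0 < n by case: i => m; case: n.
rewrite /cyc_unshift cyc_shiftD -[RHS]cyc_shift0; apply: eq_cyc_shift.
by rewrite -modnDml subnKC ?modnn ?mod0n // ltnW ?ltn_pmod.
Qed.

Lemma cyc_unshiftK n k :
  cancel (fun i : 'I_n => cyc_unshift i k) (fun i => cyc_shift i k).
Proof. by move=> i; rewrite /= /cyc_unshift cyc_shiftAC; exact: cyc_shiftK. Qed.

Lemma cyc_shift_eqP n (i j : 'I_n) k :
  cyc_shift i k = j <-> i = cyc_unshift j k.
Proof.
by split=> [<- | ->]; rewrite ?(cyc_unshiftK k j) // (cyc_shiftK k i).
Qed.

(** * The rows of the torus *)

Lemma tnth_iter_sigma T n (u : n.-tuple T) k (j : 'I_n) :
  tnth (iter k (@sigma T n) u) j = tnth u (cyc_shift j k).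
Proof.
elim: k j => [|k IHk] j; first by rewrite cyc_shift0.
have step (w : n.-tuple T) : tnth (sigma w) j = tnth w (cyc_shift j 1).
  case: n w j {u IHk} => [|n] w j; first by case: j.
  set t0 := tnth w ord0.
  rewrite !(tnth_nth t0) /= /rot nth_cat size_drop size_tuple subn1 /= nth_drop.
  have [jn | nj] := ltnP j n; first by rewrite addnC modn_small ?addn1.
  have -> : j = n :> nat by apply/eqP; rewrite eqn_leq nj -ltnS ltn_ord.
  by rewrite addn1 modnn subnn nth_take.
by rewrite iterS step IHk cyc_shiftD add1n.
Qed.

Definition row_offset n N (s : N.-tuple 'I_n) (r : nat) : nat :=
  sumn (take r.+1 (map val s)).

Lemma tnth_phi T n N (u : n.-tuple T) (s : N.-tuple 'I_n) (r : 'I_N) :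
  tnth (phi u s) r = iter (row_offset s r) (@sigma T n) u.
Proof.
have foldlE (t : seq 'I_n) (w : n.-tuple T) :
    foldl (fun w (k : 'I_n) => iter k (@sigma T n) w) w t
    = iter (sumn (map val t)) (@sigma T n) w.
  elim: t w => [|k t IHt] w //=.
  by rewrite IHt -iterD addnC.
rewrite (tnth_nth u) /= nth_scanl ?size_tuple // foldlE.
by rewrite /row_offset map_take.
Qed.

Lemma torus_of_shift T n N (u : n.-tuple T) (s : N.-tuple 'I_n) r c j :
  torus_of u s r (cyc_shift c j) =
  tnth u (cyc_shift (cyc_shift c (row_offset s r)) j).
Proof. by rewrite mxE tnth_phi tnth_iter_sigma cyc_shiftAC. Qed.

(** * Wrapping around from the last row to the first *)

Lemma dvdn_sum_ffun_coord n y (i : 'I_y) :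
  2 <= y -> n %| \sum_(f : {ffun 'I_y -> 'I_n}) f i.
Proof.
move=> y_ge2.
have [i' i'i] : exists i' : 'I_y, i' != i.
  have [i0 | i0] := eqVneq (val i) 0.
    by exists (Ordinal y_ge2); rewrite -val_eqE /= i0.
  by exists (Ordinal (ltnW y_ge2)); rewrite -val_eqE eq_sym.
(* Expanding a product of sums over the coordinates: coordinate [i] contributes
   its letter, every other coordinate the number [n] of its possible values. *)
have -> : \sum_(f : {ffun 'I_y -> 'I_n}) f i =
    \prod_(k < y) \sum_(b < n) (if k == i then val b else 1).
  rewrite bigA_distr_bigA; apply: eq_bigr => f _ /=.
  by rewrite (bigD1 i) //= eqxx big1 ?muln1 // => k /negPf ->.
rewrite (bigD1 i') //= (negPf i'i) dvdn_mulr //.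
by rewrite sum1_card card_ord.
Qed.

(** Reading the word of length [y] at each position of [s] is a bijection onto
    all words, under which a letter of [s] becomes a first letter. *)
Lemma dvdn_sum_de_bruijn n N y (s : N.-tuple 'I_n) :
  2 <= y -> de_bruijn_cycle y s -> n %| \sum_(r < N) tnth s r.
Proof.
move=> y_ge2 hs.
pose i0 : 'I_y := Ordinal (ltnW y_ge2).
pose word (r : 'I_N) : {ffun 'I_y -> 'I_n} :=
  [ffun k : 'I_y => tnth s (cyc_shift r k)].
have occP (f : {ffun 'I_y -> 'I_n}) r :
    occurs_at s (mktuple f) r <-> word r = f.
  split=> [H | <- k]; last by rewrite tnth_mktuple ffunE.
  by apply/ffunP=> k; rewrite ffunE -H tnth_mktuple.
have /fin_all_exists[pos posP] (f : {ffun 'I_y -> 'I_n}) :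
    exists r, word r = f /\ forall r', word r' = f -> r = r'.
  have [r [/occP rf r_uniq]] := hs (mktuple f).
  by exists r; split=> // r' /occP/r_uniq.
have word_bij : bijective word.
  by exists pos => z; [apply: (posP _).2 | apply: (posP _).1].
have := dvdn_sum_ffun_coord n i0 y_ge2; rewrite (reindex word) /=; last first.
  exact: onW_bij.
by congr (_ %| _); apply: eq_bigr => r _; rewrite ffunE cyc_shift0.
Qed.

(** The index [r + 1] is cyclic; when it wraps, [row_offset s r] is the sum of
    all letters, and this is why that sum has to vanish modulo [n]. *)
Lemma row_offset_shift1 n N (s : N.-tuple 'I_n) (r : 'I_N) :
    n %| \sum_(i < N) tnth s i ->
  row_offset s (cyc_shift r 1) =
  row_offset s r + tnth s (cyc_shift r 1) %[mod n].
Proof.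
move=> n_dvd; have sz : size (map val s) = N by rewrite size_map size_tuple.
have tnthE (i : 'I_N) : val (tnth s i) = nth 0 (map val s) i.
  by rewrite (nth_map (tnth s i)) ?size_tuple // -tnth_nth.
rewrite tnthE /row_offset /= addn1.
have [rN | Nr] := ltnP r.+1 N.
  by rewrite (modn_small rN) (@take_nth _ 0 r.+1) ?sz // sumn_rcons.
have rN : r.+1 = N by apply/eqP; rewrite eqn_leq Nr ltn_ord.
rewrite rN modnn (@take_oversize _ N) ?sz //.
have -> : sumn (map val s) = \sum_(i < N) tnth s i.
  by rewrite sumnE big_map big_tuple.
rewrite -modnDml (eqP n_dvd) add0n.
by case: (map val s) sz => [|b t] sz; rewrite ?take0 //= take0 addn0.
Qed.

(** * Coverings of the torus *)

(** An orbit whose steps are rotations is determined by its start and its steps: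
    this replaces [y + 1] prescribed positions by the first of them and the [y]
    consecutive differences. *)
Lemma cyc_path_eqP n y (a q b : nat -> 'I_n) :
    (forall k, a k.+1 = cyc_shift (a k) (b k)) ->
  (forall k, k <= y -> a k = q k) <->
  a 0 = q 0 /\ forall k, k < y -> b k = cyc_unshift (q k.+1) (q k).
Proof.
move=> aS; split=> [aq | [a0 bq]].
  split=> [|k ky]; first exact: aq.
  by apply/cyc_shift_eqP; rewrite cyc_shiftC -!aq ?(ltnW ky) ?aS.
elim=> [|k IHk] // ky.
by rewrite aS IHk ?(ltnW ky) // cyc_shiftC; apply/cyc_shift_eqP/bq.
Qed.

(** Decouples the two coordinates of a covering position: the second condition
    involves [r] alone, and for a given [r] the first one is solved by a single
    [c]. *)
Lemma torus_covers_atP A n N x y (u : n.-tuple (option A)) (s : N.-tuple 'I_n)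
    (P : 'M[A]_(y.+1, x)) (q : 'I_y.+1 -> 'I_n) (r : 'I_N) (c : 'I_n) :
    n %| \sum_(i < N) tnth s i ->
    (forall i j, covers_at u [tuple P i k | k < x] j <-> j = q i) ->
  torus_covers_at (torus_of u s) P (r, c) <->
  cyc_shift c (row_offset s r) = q ord0 /\
  occurs_at s [tuple cyc_unshift (q (inord k.+1)) (q (inord k)) | k < y]
    (cyc_shift r 1).
Proof.
move=> n_dvd qP.
pose a k := cyc_shift c (row_offset s (cyc_shift r k)).
pose b k := tnth s (cyc_shift (cyc_shift r 1) k).
have aS k : a k.+1 = cyc_shift (a k) (b k).
  rewrite /a /b !cyc_shiftD add1n -[k.+1]addn1 -cyc_shiftD.
  exact/eq_cyc_shift/row_offset_shift1.
have coverE : torus_covers_at (torus_of u s) P (r, c) <->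
    forall k, k <= y -> a k = q (inord k).
  split=> [cov k ky | aq i j].
    apply/qP => j; rewrite tnth_mktuple /a.
    by have := cov (inord k) j; rewrite /= torus_of_shift inordK.
  have /qP/(_ j) : a i = q i by rewrite aq ?inord_val // -ltnS.
  by rewrite tnth_mktuple /= torus_of_shift.
have a0 : a 0 = cyc_shift c (row_offset s r) by rewrite /a cyc_shift0.
have q0 : q (inord 0) = q ord0.
  by congr q; apply: val_inj; rewrite /= inordK.
apply: (iff_trans coverE).
apply: (iff_trans (cyc_path_eqP _ (fun k => q (inord k)) aS)); rewrite a0 q0.
split=> -[-> bq]; split=> // k; first by rewrite tnth_mktuple -bq.
by move=> ky; have := bq (Ordinal ky); rewrite tnth_mktuple.
Qed.

Theorem theorem6p4 (A : finType) (hA : 0 < #|A|) (x y : nat) (hx : 1 <= x)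
    (hy : 2 <= y) (n : nat) (u : n.-tuple (option A)) (hu : upcycle x u)
    (N : nat) (s : N.-tuple 'I_n) (hs : de_bruijn_cycle y s) :
  forall P : 'M[A]_(y + 1, x),
    exists! p : 'I_N * 'I_n, torus_covers_at (torus_of u s) P p.
Proof.
rewrite addn1 => P.
have /fin_all_exists[q qP] (i : 'I_y.+1) :
    exists q, forall j, covers_at u [tuple P i k | k < x] j <-> j = q.
  have [q [covq q_uniq]] := hu [tuple P i k | k < x].
  by exists q => j; split=> [/q_uniq | ->].
have coverP := torus_covers_atP _ _ (dvdn_sum_de_bruijn hy hs) qP.
have [t [occ_t t_uniq]] :=
  hs [tuple cyc_unshift (q (inord k.+1)) (q (inord k)) | k < y].
pose r := cyc_unshift t 1.
exists (r, cyc_unshift (q ord0) (row_offset s r)); split.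
  by apply/coverP; split; [apply/cyc_shift_eqP | rewrite (cyc_unshiftK 1 t)].
case=> r' c' /coverP[/cyc_shift_eqP -> /t_uniq tE].
by have -> : r' = r by apply/cyc_shift_eqP.
Qed.
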